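(* Suppose $I\subseteq\mathbb{R}\langle x,x^*\rangle$ is a left ideal generated by a (finite or infinite) sequence of homogeneous analytic polynomials $p_1,\dots,p_k,\dots$. Then $\sqrt{I}=I$.
   Context: $\mathbb{R}\langle x,x^*\rangle$ is the free unital associative $\mathbb{R}$-algebra on the $2g$ noncommuting letters $x_1,\dots,x_g,x_1^*,\dots,x_g^*$, with the $\mathbb{R}$-linear involution $*$ that exchanges $x_i$ and $x_i^*$ and reverses products. A polynomial is homogeneous if all its words have the same length, and analytic if it contains none of the letters $x_i^*$. For $X\in(\mathbb{R}^{n\times n})^g$, $p(X)$ denotes the evaluation of $p$ with $x_i\mapsto X_i$, $x_i^*\mapsto X_i^{T}$. For a left ideal $I$, $V(I)=\bigcup_{n\in\mathbb{N}}\{(X,v)\in(\mathbb{R}^{n\times n})^g\times\mathbb{R}^n : p(X)v=0 \text{ for all } p\in I\}$, and $\sqrt{I}=\{p\in\mathbb{R}\langle x,x^*\rangle : p(X)v=0\text{ for all }(X,v)\in V(I)\}$. *)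

(* Defs.v *)
From mathcomp Require Import all_boot all_order all_algebra.
From mathcomp Require Import classical_sets reals.
From mathcomp Require Import finmap monalg.

Set Implicit Arguments.
Unset Strict Implicit.
Unset Printing Implicit Defensive.

Import GRing.Theory.
Local Open Scope classical_set_scope.
Local Open Scope ring_scope.

(* [inl i] is the letter x_i and [inr i] is the letter x_i^*. *)
Notation letter g := (ordinal g + ordinal g)%type.

(* R<x, x^*>: the algebra of the free monoid on the 2g letters. *)
Notation "'{ncpoly' R [ g ] }" := {malg R[{fmonom (letter g)}]}
  (at level 0, R, g at level 2, format "'{ncpoly'  R [ g ] }") : type_scope.

Section Polynomials.
Context {R : realType} {g : nat}.
Implicit Types (p q : {ncpoly R[g]}) (I : set {ncpoly R[g]}).

Definition homogeneous p : Prop :=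
  exists d : nat, forall w, w \in msupp p -> fdeg w = d.

Definition analytic p : Prop :=
  forall (w : {fmonom (letter g)}) (i : 'I_g),
    w \in msupp p -> inr i \notin fmonom_val w.

Definition left_ideal I : Prop :=
  [/\ I 0, (forall p q, I p -> I q -> I (p + q))
    & (forall a p, I p -> I (a * p))].

Definition left_ideal_gen (G : set {ncpoly R[g]}) : set {ncpoly R[g]} :=
  smallest left_ideal G.

Section Evaluation.
Context {n : nat} (X : 'I_g -> 'M[R]_n).

Definition eval_letter (l : letter g) : 'M[R]_n :=
  match l with inl i => X i | inr i => (X i)^T end.

Definition eval_word (w : {fmonom (letter g)}) : 'M[R]_n :=
  \big[mulmx/1%:M]_(l <- fmonom_val w) eval_letter l.

Definition eval_poly p : 'M[R]_n :=
  \sum_(w <- msupp p) p@_w *: eval_word w.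

End Evaluation.

(* The part of V(I) lying in dimension n. *)
Definition variety I (n : nat) : set (('I_g -> 'M[R]_n) * 'cV[R]_n) :=
  [set Xv | forall p, I p -> eval_poly Xv.1 p *m Xv.2 = 0].

Definition radical I : set {ncpoly R[g]} :=
  [set p | forall (n : nat) (Xv : ('I_g -> 'M[R]_n) * 'cV[R]_n),
     variety I Xv -> eval_poly Xv.1 p *m Xv.2 = 0].

End Polynomials.

(* Index set of a sequence of length k ([Some k]) or infinite ([None]). *)
Definition seq_index (len : option nat) : set nat :=
  if len is Some k then `I_k else setT.

(* Main.v *)
Require Import Defs.
From mathcomp Require Import all_boot all_order all_algebra.
From mathcomp Require Import boolp classical_sets reals.
From mathcomp Require Import finmap monalg.

Import GRing.Theory Num.Theory.
Local Open Scope classical_set_scope.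
Local Open Scope ring_scope.

(* Let [G] be the set of generators.  Fix [D], and let [P] be the orthogonal
   projection of the Euclidean space spanned by the words of length at most [D]
   whose kernel is the truncation of the left ideal [I].  With [c_l] the
   operator prepending the letter [l], put
     [X_i = P (c_{x_i} + c_{x_i^*}^T) P],   [v = P 1],
   so that [X_i^T = P (c_{x_i^*} + c_{x_i}^T) P].
   Since [I] is stable under taking homogeneous parts and analytic parts, [P]
   commutes with the corresponding coordinate projections.  As [c_{x_i^*}^T]
   kills every analytic word, [w(X) v = P w] for analytic [w], hence [(X, v)] is
   in [V(I)].  For an arbitrary [w], [w(X) v] differs from [P w] by terms of
   length less than that of [w].  So if [q] in the radical has degree at most
   [D], then [P] kills its part of degree [D], which therefore lies in [I], and
   one concludes by induction on the degree. *)

(** * Orthogonal projections with a prescribed kernel *)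

Section OrthogonalProjection.
Set Implicit Arguments.
Unset Strict Implicit.
Context {R : realType} {n : nat}.
Implicit Types (K : set 'cV[R]_n) (M N P : 'M[R]_n) (x y : 'cV[R]_n).

(** Choose [B] of maximal rank among the matrices whose row space lies in [K]. Adjoining a row [x]
    from [K] cannot raise the rank, so [x] was already in the row space. *)
Lemma subspace_rowspace (K : set 'rV[R]_n) :
  K 0 -> (forall x y : 'rV_n, K x -> K y -> K (x + y)) ->
  (forall c (x : 'rV_n), K x -> K (c *: x)) ->
  exists B : 'M[R]_n, forall x : 'rV_n, (x <= B)%MS <-> K x.
Proof.
move=> K0 KD KZ.
pose inK (B : 'M[R]_n) := forall x : 'rV_n, (x <= B)%MS -> K x.
pose rk r := `[< exists2 B : 'M[R]_n, inK B & \rank B = r >].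
have exrk : exists r, rk r.
  exists 0%N; apply/asboolP; exists 0; last by rewrite mxrank0.
  by move=> x; rewrite submx0 => /eqP->.
have ubrk r : rk r -> (r <= n)%N.
  by move=> /asboolP[B _ <-]; rewrite rank_leq_row.
case: (ex_maxnP exrk ubrk) => r /asboolP[B KB rB] maxr.
exists B => x; split=> [|Kx]; first exact: KB.
have KBx : inK (B + x)%MS.
  move=> y /sub_addsmxP[[u1 u2] ->] /=; apply: KD.
    by apply: KB; apply: submxMl.
  by rewrite (mx11_scalar u2) mul_scalar_mx; apply: KZ.
have rBx : (\rank (B + x)%MS <= \rank B)%N.
  by rewrite rB; apply: maxr; apply/asboolP; exists (B + x)%MS.
have sB : (B <= B + x)%MS by apply: addsmxSl.
have /geq_leqif := mxrank_leqif_sup sB; rewrite rBx => /esym sBx.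
by apply: submx_trans sBx; apply: addsmxSr.
Qed.

(** The scalar [(u *m A) *m (u *m A)^T] is a sum of real squares, so its vanishing kills each entry
    of [u *m A]. *)
Lemma gram_mulmx_eq0 m (A : 'M[R]_(m, n)) (u : 'rV_m) :
  u *m (A *m A^T) = 0 -> u *m A = 0.
Proof.
move=> uAA; have: (u *m A) *m (u *m A)^T = 0.
  by rewrite trmx_mul mulmxA -[u *m A *m _]mulmxA uAA mul0mx.
move=> /matrixP/(_ 0 0); rewrite !mxE => /eqP.
rewrite psumr_eq0 => [/allP s0|i _]; last by rewrite [_^T _ _]mxE -expr2 sqr_ge0.
apply/rowP=> j; have := s0 j (mem_index_enum _).
by rewrite [_^T _ _]mxE mulf_eq0 orbb => /eqP->; rewrite mxE.
Qed.

(** If the rows of [B] form a basis of the transposes of [K], then the Gram matrix [G] of [B] is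
    invertible, [B^T G^-1 B] projects onto [K], and [P] is the complementary projection. *)
Lemma orthogonal_projection K :
  K 0 -> (forall x y, K x -> K y -> K (x + y)) ->
  (forall c x, K x -> K (c *: x)) ->
  exists P, [/\ P^T = P, P *m P = P & forall x, P *m x = 0 <-> K x].
Proof.
move=> K0 KD KZ.
have [||| B0 B0P] := @subspace_rowspace [set x | K x^T].
- by rewrite /= trmx0.
- by move=> x y /= Kx Ky; rewrite linearD /=; apply: KD.
- by move=> c x /= Kx; rewrite linearZ /=; apply: KZ.
move: (row_base B0) (row_base_free B0) (eq_row_base B0) => B Bfree BB0.
pose G := B *m B^T.
have Gu : G \in unitmx.
  rewrite -row_free_unit -kermx_eq0 -submx0; apply/rV_subP => u /sub_kermxP uG.
  have /sub_kermxP := gram_mulmx_eq0 uG.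
  by move: Bfree; rewrite -kermx_eq0 => /eqP->.
have GT : (invmx G)^T = invmx G by rewrite trmx_inv /G trmx_mul trmxK.
pose Q := B^T *m invmx G *m B.
have BQ : B *m Q = B by rewrite /Q !mulmxA mulmxV // mul1mx.
have QT : Q^T = Q by rewrite /Q !trmx_mul trmxK GT mulmxA.
have QB : Q *m B^T = B^T by rewrite -{1}QT -trmx_mul BQ.
have QQ : Q *m Q = Q by rewrite {1}/Q -mulmxA BQ.
exists (1%:M - Q); split.
- by rewrite linearB /= trmx1 QT.
- by rewrite mulmxBl mul1mx mulmxBr mulmx1 QQ subrr subr0.
move=> x; rewrite -[x in K x]trmxK -[K _]/([set x | K x^T] _) -B0P mulmxBl mul1mx.
rewrite -BB0.
split=> [/eqP|/submxP[u xu]].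
  rewrite subr_eq0 => /eqP->.
  by rewrite trmx_mul QT /Q mulmxA; apply: submxMl.
by rewrite -[x]trmxK xu trmx_mul mulmxA QB subrr.
Qed.

Lemma mulmx_cV_inj M N : (forall x, M *m x = N *m x) -> M = N.
Proof.
move=> MN; apply/matrixP => i j.
by have /matrixP/(_ i 0) := MN (delta_mx j 0); rewrite -!colE !mxE.
Qed.

(** The vector [x - P *m x] is killed by [P], hence lies in [K]; [M] keeps it there, and [P] kills
    the image. *)
Lemma projection_stable K P M x :
  P *m P = P -> (forall y, P *m y = 0 <-> K y) ->
  (forall y, K y -> K (M *m y)) ->
  P *m (M *m (P *m x)) = P *m (M *m x).
Proof.
move=> PP PK KM; apply/esym/eqP; rewrite -subr_eq0 -!mulmxBr; apply/eqP.
by apply/PK/KM/PK; rewrite mulmxBr mulmxA PP subrr.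
Qed.

(** Stability of the kernel gives [PMP = PM]; transposing this identity gives [PMP = MP]. *)
Lemma projection_comm K P M :
  P^T = P -> P *m P = P -> (forall y, P *m y = 0 <-> K y) ->
  M^T = M -> (forall y, K y -> K (M *m y)) -> P *m M = M *m P.
Proof.
move=> PT PP PK MT KM.
have PMP : P *m M *m P = P *m M.
  by apply: mulmx_cV_inj => x; rewrite -!mulmxA (projection_stable _ PP PK KM).
have /(congr1 trmx) := PMP; rewrite !trmx_mul PT MT mulmxA => <-.
by rewrite PMP.
Qed.

End OrthogonalProjection.

(** * Restricting polynomials to a language of words *)

Section Polynomials.
Set Implicit Arguments.
Unset Strict Implicit.
Context {R : realType} {g : nat}.
Local Notation word := {fmonom (letter g)}.
Local Notation poly := {ncpoly R[g]}.
Implicit Types (p q f : poly) (w u : word) (S : pred word) (I : set poly).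

Lemma ncpoly_ind (Q : poly -> Prop) :
  (forall p q, Q p -> Q q -> Q (p + q)) ->
  (forall c w, Q << c *g w >>) -> forall p, Q p.
Proof.
move=> QD QU p; rewrite [p]monalgE; elim/big_ind: _ => //.
by have := QU 0 mone; rewrite monalgU0.
Qed.

Definition restrict S p : poly :=
  [malg w in msupp p => if S w then p@_w else 0].

Lemma mcoeff_restrict S p w : (restrict S p)@_w = if S w then p@_w else 0.
Proof. by rewrite mcoeffE; case: msuppP => // _; rewrite if_same. Qed.

Lemma restrictD S p q : restrict S (p + q) = restrict S p + restrict S q.
Proof.
apply/malgP => w; rewrite mcoeffD !mcoeff_restrict mcoeffD.
by case: ifP; rewrite ?addr0.
Qed.

Lemma restrictU S c w :
  restrict S << c *g w >> = if S w then << c *g w >> else 0.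
Proof.
apply/malgP => u; rewrite mcoeff_restrict; case: (eqVneq w u) => [->|wu].
  by case: ifP; rewrite ?mcoeff0.
rewrite mcoeffU (negPf wu) mulr0n if_same; case: ifP; rewrite ?mcoeff0 //.
by rewrite mcoeffU (negPf wu).
Qed.

Lemma restrict_id S p : {in msupp p, forall w, S w} -> restrict S p = p.
Proof.
move=> Sp; apply/malgP => w; rewrite mcoeff_restrict.
by case: ifP => // Sw; apply/esym/mcoeff_outdom/negP => /Sp; rewrite Sw.
Qed.

Lemma restrict_none S p : {in msupp p, forall w, ~~ S w} -> restrict S p = 0.
Proof.
move=> Sp; apply/malgP => w; rewrite mcoeff_restrict mcoeff0.
by case: ifP => // Sw; apply/mcoeff_outdom/negP => /Sp; rewrite Sw.
Qed.

Lemma restrictM S c u p :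
  restrict S (<< c *g u >> * p) = << c *g u >> * restrict (fun w => S (mmul u w)) p.
Proof.
elim/ncpoly_ind: p => [p q IHp IHq|c' w].
  by rewrite mulrDr !restrictD IHp IHq mulrDr.
rewrite malgM_def fgmulUU !restrictU; case: ifP => _; last by rewrite mulr0.
by rewrite malgM_def fgmulUU.
Qed.

(* Every left quotient [u^-1 S] of the language [S] contains all or none of the
   words of each generator: this passes from the generators to the left ideal,
   and makes it closed under [restrict S]. *)
Definition quotient_stable S (G : set poly) : Prop :=
  forall u p, G p ->
    {in msupp p, forall w, S (mmul u w)} \/ {in msupp p, forall w, ~~ S (mmul u w)}.

Lemma left_ideal_genP (G : set poly) : left_ideal (left_ideal_gen G).
Proof.
split=> [J [[]]//|p q Ip Iq J JG|a p Ip J JG]; have [[_ JD JM] _] := JG.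
  by apply: JD; [apply: Ip|apply: Iq].
by apply: JM; apply: Ip.
Qed.

Lemma restrict_left_ideal_gen S (G : set poly) p :
  quotient_stable S G -> left_ideal_gen G p -> left_ideal_gen G (restrict S p).
Proof.
move=> SG; have [I0 ID IM] := left_ideal_genP G => Ip.
(* Quantifying over all prefixes [u] makes the set on the right a left ideal: multiplying by a word
   [v] replaces [u] by [uv]. The claim is the case of the empty prefix. *)
suff Isub : left_ideal_gen G `<=`
    [set p | forall u, left_ideal_gen G (restrict (fun w => S (mmul u w)) p)].
  have := Isub p Ip mone; congr left_ideal_gen; apply/malgP => w.
  by rewrite !mcoeff_restrict monalg.mul1m.
apply: smallest_sub => [|{Ip}p Gp u]; last first.
  have [/restrict_id->|/restrict_none->//] := SG u p Gp.
  exact: sub_gen_smallest.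
split=> [u|{Ip}p q Ip Iq u|a {Ip}p Ip u]; first by rewrite restrict_none // msupp0.
  by rewrite restrictD; apply: ID.
elim/ncpoly_ind: a => [a b IHa IHb|c v].
  by rewrite mulrDl restrictD; apply: ID.
rewrite restrictM; apply: IM.
suff -> : restrict (fun w => S (mmul u (mmul v w))) p =
    restrict (fun w => S (mmul (mmul u v) w)) p by [].
by apply/malgP => w; rewrite !mcoeff_restrict monalg.mulmA.
Qed.

(** * Linear extension from words, and evaluation *)

Definition mlinear (V : lmodType R) (h : word -> V) p : V :=
  \sum_(w <- msupp p) p@_w *: h w.

Section MLinear.
Context {V : lmodType R} (h : word -> V).

Lemma mlinearEw (d : {fset word}) p : (msupp p `<=` d)%fset ->
  mlinear h p = \sum_(w <- d) p@_w *: h w.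
Proof.
move=> pd; rewrite /mlinear (big_fset_incl _ pd) // => w _ wp.
by rewrite mcoeff_outdom ?scale0r.
Qed.

Lemma mlinearD p q : mlinear h (p + q) = mlinear h p + mlinear h q.
Proof.
rewrite (@mlinearEw (msupp p `|` msupp q)%fset) ?msuppD_le //.
rewrite (@mlinearEw (msupp p `|` msupp q)%fset p) ?fsubsetUl //.
rewrite (@mlinearEw (msupp p `|` msupp q)%fset q) ?fsubsetUr //.
by rewrite -big_split; apply: eq_bigr => w _; rewrite mcoeffD scalerDl.
Qed.

Lemma mlinearU c w : mlinear h << c *g w >> = c *: h w.
Proof.
rewrite (@mlinearEw [fset w]%fset) ?msuppU_le //.
by rewrite big_seq_fset1 mcoeffUU.
Qed.

Lemma mlinear0 : mlinear h 0 = 0.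
Proof. by rewrite /mlinear msupp0 big_seq_fset0. Qed.

End MLinear.

Section Eval.
Context {n : nat} (X : 'I_g -> 'M[R]_n).

Lemma eval_polyD p q : eval_poly X (p + q) = eval_poly X p + eval_poly X q.
Proof. exact: mlinearD. Qed.

Lemma eval_polyU c w : eval_poly X << c *g w >> = c *: eval_word X w.
Proof. exact: mlinearU. Qed.

Lemma eval_poly0 : eval_poly X 0 = 0.
Proof. exact: mlinear0. Qed.

Lemma eval_wordM w u : eval_word X (mmul w u) = eval_word X w *m eval_word X u.
Proof.
rewrite /eval_word fmM; elim: (fmonom_val w) => [|l s IHs] /=.
  by rewrite big_nil mul1mx.
by rewrite !big_cons IHs mulmxA.
Qed.

Lemma eval_polyM p q : eval_poly X (p * q) = eval_poly X p *m eval_poly X q.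
Proof.
elim/ncpoly_ind: p => [p p' IHp IHp'|c w].
  by rewrite mulrDl !eval_polyD IHp IHp' mulmxDl.
elim/ncpoly_ind: q => [q q' IHq IHq'|c' w'].
  by rewrite mulrDr !eval_polyD IHq IHq' mulmxDr.
rewrite malgM_def fgmulUU !eval_polyU eval_wordM.
by rewrite -scalemxAl -scalemxAr scalerA.
Qed.

Lemma variety_left_ideal_gen (v : 'cV[R]_n) (G : set poly) :
  (forall p, G p -> eval_poly X p *m v = 0) -> variety (left_ideal_gen G) (X, v).
Proof.
move=> Gv; apply: smallest_sub => [|p /Gv//]; split=> /=.
- by rewrite eval_poly0 mul0mx.
- by move=> p q pv qv; rewrite eval_polyD mulmxDl pv qv addr0.
- by move=> a p pv; rewrite eval_polyM -mulmxA pv mulmx0.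
Qed.

End Eval.

(** * Stability under analytic parts and under length *)

Section Gradings.
Context (G : set poly).
Hypothesis G_homogeneous : forall p, G p -> homogeneous p.
Hypothesis G_analytic : forall p, G p -> analytic p.

Definition analytic_word : pred word :=
  fun w => all (fun l : letter g => if l is inl _ then true else false) w.

Lemma analytic_wordM u w :
  analytic_word (mmul u w) = analytic_word u && analytic_word w.
Proof. by rewrite /analytic_word fmM all_cat. Qed.

Lemma analyticP p : analytic p -> {in msupp p, forall w, analytic_word w}.
Proof.
by move=> Ap w wp; apply/allP => -[//|i] iw; have := Ap w i wp; rewrite iw.
Qed.

Lemma quotient_stable_analytic : quotient_stable analytic_word G.
Proof.
move=> u p /G_analytic/analyticP Ap; case: (boolP (analytic_word u)) => Au.
  by left => w /Ap Aw; rewrite analytic_wordM Au.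
by right => w _; rewrite analytic_wordM (negPf Au).
Qed.

Lemma quotient_stable_fdeg (phi : pred nat) :
  quotient_stable (fun w => phi (fdeg w)) G.
Proof.
move=> u p /G_homogeneous[d pd]; case: (boolP (phi (fdeg u + d)%N)) => ud.
  by left => w /pd wd; rewrite fdegM wd.
by right => w /pd wd; rewrite fdegM wd.
Qed.

End Gradings.

(** * Coordinates on the words of length at most [D] *)

Section TruncatedWords.
Context {D : nat}.
Local Notation N := #|{: D.-bseq (letter g)}|.

Definition word_of (i : 'I_N) : word := FMonom (bseqval (enum_val i)).

Lemma fdeg_word_of i : (fdeg (word_of i) <= D)%N.
Proof. exact: size_bseq. Qed.

Lemma word_of_inj : injective word_of.
Proof. by move=> i j [] /val_inj/enum_val_inj. Qed.

Lemma word_of_surj w : (fdeg w <= D)%N -> exists i, word_of i = w.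
Proof.
case: w => s sD; exists (enum_rank (Bseq sD : D.-bseq (letter g))).
by rewrite /word_of enum_rankK.
Qed.

Definition coefs p : 'cV[R]_N := \col_i p@_(word_of i).

Lemma coefsD p q : coefs (p + q) = coefs p + coefs q.
Proof. by apply/colP => i; rewrite !mxE mcoeffD. Qed.

Lemma coefsZ c p : coefs (c *: p) = c *: coefs p.
Proof. by apply/colP => i; rewrite !mxE mcoeffZ. Qed.

Lemma coefs0 : coefs 0 = 0.
Proof. by apply/colP => i; rewrite !mxE mcoeff0. Qed.

Lemma coefsE p : coefs p = mlinear (fun w => coefs << w >>) p.
Proof.
elim/ncpoly_ind: p => [p q IHp IHq|c w]; first by rewrite coefsD mlinearD IHp IHq.
rewrite mlinearU -coefsZ; congr coefs; apply/malgP => u.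
by rewrite mcoeffZ !mcoeffU mulr_natr.
Qed.

Definition letter_word (l : letter g) : word := FMonom [:: l].

(** The operator is truncated: a word of length [D] is sent to 0, as no index carries the longer
    word. *)
Definition creation l : 'M[R]_N :=
  \matrix_(i, j) (word_of i == mmul (letter_word l) (word_of j))%:R.

Lemma coefsM l p : coefs (<< letter_word l >> * p) = creation l *m coefs p.
Proof.
elim/ncpoly_ind: p => [p q IHp IHq|c w].
  by rewrite mulrDr !coefsD IHp IHq mulmxDr.
apply/colP => i; rewrite malgM_def fgmulUU mul1r !mxE mcoeffU.
have [iw|iw] := eqVneq; last first.
  rewrite big1 // => j _; rewrite !mxE mcoeffU; case: (eqVneq w) => [wj|].
    by rewrite -wj eq_sym (negPf iw) mul0r.
  by rewrite mulr0.
(* When the product is short enough to be a coordinate, so is its suffix [w]; truncating before or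
   after prepending thus gives the same result. *)
have [j jw] : exists j, word_of j = w.
  apply: word_of_surj; have := fdeg_word_of i; rewrite -iw fdegM.
  by apply: leq_trans; rewrite leq_addl.
rewrite (bigD1 j) //= !mxE mcoeffU jw -iw !eqxx mul1r big1 ?addr0 // => k kj.
rewrite !mxE mcoeffU -jw (inj_eq word_of_inj) [j == k]eq_sym (negPf kj) mulr0 //.
Qed.

Definition mask S : 'M[R]_N := diag_mx (\row_i (S (word_of i))%:R).

Lemma maskT S : (mask S)^T = mask S.
Proof. exact: tr_diag_mx. Qed.

Lemma coefs_restrict S p : coefs (restrict S p) = mask S *m coefs p.
Proof.
apply/colP => i; rewrite mul_diag_mx !mxE mcoeff_restrict.
by case: (S _); rewrite ?mul1r ?mul0r.
Qed.

Lemma creation_mask l S S' :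
  (forall w, S (mmul (letter_word l) w) = S' w) ->
  mask S *m creation l = creation l *m mask S'.
Proof.
move=> SS'; rewrite mul_diag_mx mul_mx_diag; apply/matrixP => i j; rewrite !mxE.
by case: eqP => [->|_]; rewrite ?mulr0 ?mul0r // mulr1 mul1r SS'.
Qed.

Lemma maskMl S S' : mask S *m mask S' = mask (fun w => S w && S' w).
Proof.
rewrite /mask mulmx_diag; congr diag_mx; apply/rowP => i; rewrite !mxE.
by rewrite -natrM mulnb.
Qed.

(** The transpose strips a leading [x_i^*], and no analytic word begins with that letter. *)
Lemma creation_star_analytic i : (creation (inr i))^T *m mask analytic_word = 0.
Proof.
apply: trmx_inj; rewrite trmx_mul maskT trmxK trmx0.
apply/matrixP => j k; rewrite mul_diag_mx !mxE.
by case: eqP => [->|_]; rewrite ?mulr0 // analytic_wordM /= mul0r.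
Qed.

(** This says that [x] is supported on words of length strictly less than [k]. *)
Definition low k (x : 'cV[R]_N) : Prop := mask (fun w => k <= fdeg w)%N *m x = 0.

Lemma lowD k x y : low k x -> low k y -> low k (x + y).
Proof. by rewrite /low mulmxDr => -> ->; rewrite addr0. Qed.

Lemma lowZ k c x : low k x -> low k (c *: x).
Proof. by rewrite /low -scalemxAr => ->; rewrite scaler0. Qed.

Lemma low0 k : low k 0.
Proof. by rewrite /low mulmx0. Qed.

Lemma low_leq k m x : (k <= m)%N -> low k x -> low m x.
Proof.
move=> km kx; rewrite /low.
suff -> : mask (fun w => m <= fdeg w)%N =
    mask (fun w => m <= fdeg w)%N *m mask (fun w => k <= fdeg w)%N.
  by rewrite -mulmxA kx mulmx0.
rewrite maskMl /mask; congr diag_mx; apply/rowP => i; rewrite !mxE; congr (_%:R).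
by case: leqP => // mi; rewrite (leq_trans km mi).
Qed.

Lemma low_creation k l x : low k x -> low k.+1 (creation l *m x).
Proof.
rewrite /low mulmxA (@creation_mask _ _ (fun w => k <= fdeg w)%N).
  by rewrite -mulmxA => ->; rewrite mulmx0.
by move=> w; rewrite fdegM.
Qed.

Lemma low_annihilation k l x : low k.+1 x -> low k ((creation l)^T *m x).
Proof.
rewrite /low => kx; rewrite mulmxA -maskT -trmx_mul.
rewrite -(@creation_mask _ (fun w => k.+1 <= fdeg w)%N); last first.
  by move=> w; rewrite fdegM.
by rewrite trmx_mul maskT -mulmxA kx mulmx0.
Qed.

Lemma low_coefs w : low (fdeg w).+1 (coefs << w >>).
Proof.
rewrite /low -coefs_restrict restrictU ltnn; exact: coefs0.
Qed.

(** * The point of the variety built from [P], and its leading terms *)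

Section Model.
Context (G : set poly).
Local Notation I := (left_ideal_gen G).
Hypothesis G_homogeneous : forall p, G p -> homogeneous p.
Hypothesis G_analytic : forall p, G p -> analytic p.

Context (P : 'M[R]_N).
Hypothesis PT : P^T = P.
Hypothesis PP : P *m P = P.
Hypothesis PK : forall x, P *m x = 0 <-> [set coefs p | p in I] x.

Lemma projection_mask S : quotient_stable S G -> P *m mask S = mask S *m P.
Proof.
move=> SG; apply: (projection_comm PT PP PK (maskT S)) => _ [p Ip <-].
by exists (restrict S p); [apply: restrict_left_ideal_gen|apply: coefs_restrict].
Qed.

Lemma projection_creation l (x : 'cV[R]_N) :
  P *m (creation l *m (P *m x)) = P *m (creation l *m x).
Proof.
apply: (projection_stable _ PP PK) => _ [p Ip <-].
exists (<< letter_word l >> * p); last exact: coefsM.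
by have [_ _] := left_ideal_genP G; apply.
Qed.

Definition flip (l : letter g) : letter g :=
  match l with inl i => inr i | inr i => inl i end.

Definition compressed l : 'M[R]_N :=
  P *m (creation l + (creation (flip l))^T) *m P.

Definition model (i : 'I_g) : 'M[R]_N := compressed (inl i).

Definition vacuum : 'cV[R]_N := P *m coefs << mone >>.

Lemma eval_letter_model l : eval_letter model l = compressed l.
Proof.
case: l => //= i; rewrite /model /compressed /= !trmx_mul PT linearD /= trmxK.
by rewrite addrC mulmxA.
Qed.

Lemma compressedM l (x : 'cV[R]_N) : P *m x = x ->
  compressed l *m x = P *m (creation l *m x) + P *m ((creation (flip l))^T *m x).
Proof. by move=> Px; rewrite /compressed -!mulmxA Px mulmxDl mulmxDr. Qed.

Lemma eval_word_cons l w :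
  eval_word model (mmul (letter_word l) w) *m vacuum =
  compressed l *m (eval_word model w *m vacuum).
Proof.
by rewrite eval_wordM /eval_word /= big_cons big_nil mulmx1 eval_letter_model mulmxA.
Qed.

Lemma word_ind (Q : word -> Prop) :
  Q mone -> (forall l w, Q w -> Q (mmul (letter_word l) w)) -> forall w, Q w.
Proof.
move=> Q1 QM [s]; elim: s => [|l s /(QM l)]; first by rewrite -fmoneE.
by rewrite [mmul _ _]fmmulE.
Qed.

Lemma eval_word1 : eval_word model mone *m vacuum = vacuum.
Proof. by rewrite /eval_word fm1 big_nil mul1mx. Qed.

Lemma coefs_cons l w :
  coefs << mmul (letter_word l) w >> = creation l *m coefs << w >>.
Proof. by rewrite -coefsM malgM_def fgmulUU mulr1. Qed.

Lemma eval_analytic_word w : analytic_word w ->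
  eval_word model w *m vacuum = P *m coefs << w >>.
Proof.
elim/word_ind: w => [_|l w IHw]; first exact: eval_word1.
rewrite analytic_wordM => /andP[Al Aw].
rewrite eval_word_cons {}IHw // compressedM ?mulmxA ?PP // -!mulmxA.
rewrite projection_creation -coefs_cons.
case: l Al => // i _ /=.
(* The mask is inserted in order to move it across [P], up against the transposed creation operator
   that annihilates it. *)
have -> : coefs << w >> = mask analytic_word *m coefs << w >>.
  by rewrite -coefs_restrict restrictU Aw.
rewrite (mulmxA P (mask _)) (projection_mask (quotient_stable_analytic G_analytic)).
by rewrite !mulmxA -(mulmxA P) creation_star_analytic mulmx0 !mul0mx addr0.
Qed.

Lemma eval_polyE X p (v : 'cV[R]_N) :
  eval_poly X p *m v = \sum_(w <- msupp p) p@_w *: (eval_word X w *m v).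
Proof.
by rewrite mulmx_suml; apply: eq_bigr => w _; rewrite scalemxAl.
Qed.

Lemma proj_coefsE p :
  P *m coefs p = \sum_(w <- msupp p) p@_w *: (P *m coefs << w >>).
Proof.
rewrite coefsE mulmx_sumr; apply: eq_bigr => w _; by rewrite scalemxAr.
Qed.

Lemma model_variety : variety I (model, vacuum).
Proof.
apply: variety_left_ideal_gen => p Gp.
have -> : eval_poly model p *m vacuum = P *m coefs p.
  rewrite eval_polyE proj_coefsE !big_seq; apply: eq_bigr => w wp.
  by rewrite eval_analytic_word // (analyticP (G_analytic Gp)).
by apply/PK; exists p => //; apply: sub_gen_smallest.
Qed.

Lemma low_projection k x : low k x -> low k (P *m x).
Proof.
rewrite /low => kx; rewrite mulmxA -projection_mask -?mulmxA ?kx ?mulmx0 //.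
exact: (quotient_stable_fdeg G_homogeneous (fun d => k <= d)%N).
Qed.

(** Prepending a letter lengthens the error by at most one, while the transposed part of
    [compressed l] shortens words; only the creation part reaches the new top length, and it yields
    [P] of the new word. *)
Lemma eval_word_lead w :
  low (fdeg w) (eval_word model w *m vacuum - P *m coefs << w >>).
Proof.
elim/word_ind: w => [|l w IHw].
  by rewrite eval_word1 subrr; apply: low0.
rewrite eval_word_cons fdegM /= add1n.
set r := _ - _ in IHw.
have -> : eval_word model w *m vacuum = P *m coefs << w >> + r.
  by rewrite addrC subrK.
have lowT k x : low k.+1 x -> low k (P *m ((creation (flip l))^T *m (P *m x))).
  by move=> kx; apply/low_projection/low_annihilation/low_projection.
have TE (x : 'cV[R]_N) : compressed l *m x =
    P *m (creation l *m (P *m x)) + P *m ((creation (flip l))^T *m (P *m x)).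
  by rewrite /compressed -!mulmxA mulmxDl mulmxDr.
rewrite mulmxDr !TE [P *m (P *m _)]mulmxA PP projection_creation coefs_cons.
rewrite addrAC [X in X - _]addrC addrK.
(* Three terms survive the cancellation: the transposed operator on the leading term, then the
   creation operator and the transposed operator on the error [r]. *)
apply: lowD; last apply: lowD.
- by apply: low_leq (leqnSn _) _; apply: lowT; apply: low_coefs.
- by apply/low_projection/low_creation/low_projection.
- apply: low_leq (leqnSn _) _; apply: lowT; exact: low_leq (leqnSn _) IHw.
Qed.

Lemma eval_poly_lead p : {in msupp p, forall w, fdeg w <= D}%N ->
  low D (eval_poly model p *m vacuum - P *m coefs p).
Proof.
move=> pD; rewrite eval_polyE proj_coefsE -sumrB big_seq.
elim/big_ind: _ => [|x y|w wp]; [exact: low0|exact: lowD|].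
rewrite -scalerBr; apply: lowZ; apply: low_leq (pD w wp) _.
exact: eval_word_lead.
Qed.

Lemma radical_top p : radical I p -> {in msupp p, forall w, fdeg w <= D}%N ->
  I (restrict (fun w => D <= fdeg w)%N p).
Proof.
move=> rp pD; set q := restrict _ p.
have stable := quotient_stable_fdeg G_homogeneous.
(* The evaluation of [p] at the model vanishes, so [P *m coefs p] has no part of length [D]; that
   part is [P *m coefs q], since [P] commutes with the mask. *)
have : P *m coefs q = 0.
  rewrite coefs_restrict mulmxA (projection_mask (stable (fun d => D <= d)%N)).
  have := eval_poly_lead pD.
  rewrite (rp _ _ model_variety) sub0r /low mulmxN -mulmxA => /eqP.
  by rewrite oppr_eq0 => /eqP.
move=> /PK[f If fq].
(* The element [f] of the ideal agrees with [q] only up to length [D]; cutting off its longer words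
   stays in the ideal and recovers [q]. *)
suff -> : q = restrict (fun w => fdeg w <= D)%N f.
  by apply: restrict_left_ideal_gen If; apply: (stable (fun d => d <= D)%N).
apply/malgP => w; rewrite !mcoeff_restrict; case: (leqP (fdeg w) D) => wD.
  have [i <-] := word_of_surj wD.
  by have /colP/(_ i) := fq; rewrite !mxE mcoeff_restrict => ->.
rewrite ltnW //; apply: mcoeff_outdom; apply/negP => /pD.
by rewrite leqNgt wD.
Qed.

End Model.
End TruncatedWords.

(** Induction on a strict degree bound: the top part lies in the ideal, hence vanishes on the
    variety, so the remainder is again in the radical and has a smaller bound. *)
Lemma radical_left_ideal_gen (G : set poly) :
  (forall p, G p -> homogeneous p) -> (forall p, G p -> analytic p) ->
  radical (left_ideal_gen G) = left_ideal_gen G.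
Proof.
move=> Gh Ga; apply/seteqP; split=> [p rp|p Ip n Xv]; last exact.
have [I0 ID IM] := left_ideal_genP G.
have [n pn] : exists n, {in msupp p, forall w, fdeg w < n}%N.
  by exists (mmeasure (@fdeg _) p) => w; apply: mmeasure_mnm_lt.
elim: n p rp pn => [|D IHD] p rp pD.
  suff -> : p = 0 by [].
  apply/malgP => w; rewrite mcoeff0; apply: mcoeff_outdom; apply/negP => /pD.
  by rewrite ltn0.
set topw := fun w => (D <= fdeg w)%N.
have Itop : left_ideal_gen G (restrict topw p).
  have [||| P [PT PP PK]] := @orthogonal_projection R #|{: D.-bseq (letter g)}|
      [set coefs p | p in left_ideal_gen G].
  - by exists 0; rewrite ?coefs0.
  - by move=> _ _ [a Ia <-] [b Ib <-]; exists (a + b); [apply: ID|rewrite coefsD].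
  - move=> c _ [a Ia <-]; exists (c *: a); last by rewrite coefsZ.
    by rewrite -mul_malgC; apply: IM.
  exact: (radical_top Gh Ga PT PP PK).
have pE : p = restrict (predC topw) p + restrict topw p.
  apply/malgP => w; rewrite mcoeffD !mcoeff_restrict /=.
  by case: (topw w); rewrite ?add0r ?addr0.
rewrite pE; apply: ID => //; apply: IHD.
  move=> n Xv VXv; have := rp n Xv VXv; rewrite {1}pE eval_polyD mulmxDl.
  by rewrite [X in _ + X](VXv _ Itop) addr0.
move=> w; rewrite -mcoeff_neq0 mcoeff_restrict /= /topw -ltnNge.
by case: ifP; rewrite ?eqxx.
Qed.

End Polynomials.

Theorem proposition2p3 (R : realType) (g : nat) (len : option nat)
    (p : nat -> {ncpoly R[g]}) (I : set {ncpoly R[g]}) :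
  (forall k, seq_index len k -> homogeneous (p k) /\ analytic (p k)) ->
  I = left_ideal_gen [set p k | k in seq_index len] ->
  radical I = I.
Proof.
move=> hp ->; apply: radical_left_ideal_gen => _ [k /hp[hk ak] <-] //.
Qed.
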